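(* Let $r_\star:\mathcal X\to(0,\infty)$ be a function, let $\hat r:\mathcal X\to(0,\infty)$ be a deterministic approximation of $r_\star$, and define $\eta(Z):=\max_{i\in[n+m]}|\log\hat r(Z_i)-\log r_\star(Z_i)|$. Let $T:\mathcal X^{n+m}\to\mathbb R$ be a test statistic and $H\ge1$. Let $$p_{\hat r}=\frac{1+\sum_{h=1}^H\mathbb 1\{T(Z_{\hat r}^{(h)})\ge T(Z)\}}{1+H},$$ where $Z_{\hat r}^{(h)}:=Z_{\sigma^{(h)}}$ and, conditionally on $Z$, $\sigma^{(1)},\ldots,\sigma^{(H)}$ are i.i.d. with $$\mathbb P\{\sigma^{(h)}=\sigma\mid Z\}=\frac{\prod_{i=n+1}^{n+m}\hat r(Z_{\sigma(i)})}{\sum_{\tilde\sigma\in\mathcal S_{n+m}}\prod_{i=n+1}^{n+m}\hat r(Z_{\tilde\sigma(i)})},\qquad\sigma\in\mathcal S_{n+m}.$$ Define $p_{r_\star}$ analogously, replacing $\hat r$ by $r_\star$ throughout (with the same $T$ and $H$). Then for all $\alpha\in(0,1)$, $$\mathbb P\{p_{\hat r}\le\alpha\}\ge\mathbb P\{p_{r_\star}\le\alpha\}-H\,\mathbb E_Z\left[\sqrt{1-\exp\{-2m\,\eta(Z)\}}\right].$$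
   Context: $n,m\ge1$; $Z=(Z_1,\ldots,Z_{n+m})=(X_1,\ldots,X_n,Y_1,\ldots,Y_m)$ consists of independent random variables in $\mathcal X$ with $X_i\sim f$ and $Y_j\sim g$, where $f,g$ are probability densities with respect to a common dominating measure. $\mathcal S_{n+m}$ is the group of permutations of $[n+m]$ and $x_\sigma:=(x_{\sigma(1)},\ldots,x_{\sigma(n+m)})$. *)

(* Defs.v *)
From mathcomp Require Import all_boot all_order all_algebra.
From mathcomp Require Import perm.
From mathcomp Require Import all_classical all_reals all_analysis.

Set Implicit Arguments.
Unset Strict Implicit.
Unset Printing Implicit Defensive.

Import Order.TTheory GRing.Theory Num.Theory.
Import numFieldNormedType.Exports.

Local Open Scope classical_set_scope.
Local Open Scope ring_scope.

Section densities.
Context d (X : measurableType d) (R : realType).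

Definition prob_density (nu : {measure set X -> \bar R}) (f : X -> R) : Prop :=
  [/\ measurable_fun [set: X] f, (forall x, 0 <= f x)
    & (\int[nu]_x (f x)%:E = 1)%E].

Definition has_density d' (Omega : measurableType d') (P : probability Omega R)
    (V : {RV P >-> X}) (nu : {measure set X -> \bar R}) (f : X -> R) : Prop :=
  forall B : set X, measurable B ->
    (distribution P V B = \int[nu]_(x in B) (f x)%:E)%E.

End densities.

Section independence.
Context d (Omega : measurableType d) (R : realType) (P : probability Omega R).

Definition independent_RVs d' (X : measurableType d') (I : finType)
    (V : I -> {RV P >-> X}) : Prop :=
  forall (J : {set I}) (B : I -> set X), (forall i, measurable (B i)) ->
    (P (\bigcap_(i in [set` J]) V i @^-1` B i)
     = \prod_(i in J) P (V i @^-1` B i))%E.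

(* q \o Z is a version of the conditional probability P(E | Z). *)
Definition is_cond_prob d' (S : measurableType d') (Z : Omega -> S)
    (E : set Omega) (q : S -> R) : Prop :=
  [/\ measurable E, measurable_fun [set: S] q
    & forall B : set S, measurable B ->
        (P (E `&` Z @^-1` B) = \int[P]_(w in Z @^-1` B) (q (Z w))%:E)%E].

(* Since A is finite, both the common law and the conditional independence are
   expressed through point masses. *)
Definition cond_iid d' (S : measurableType d') (Z : Omega -> S)
    (A : finType) (H : nat) (sigma : 'I_H -> Omega -> A)
    (law : S -> A -> R) : Prop :=
  (forall (h : 'I_H) (a : A),
     is_cond_prob Z (sigma h @^-1` [set a]) (fun z => law z a)) /\
  (forall a : 'I_H -> A,
     is_cond_prob Z (\bigcap_(h in [set: 'I_H]) sigma h @^-1` [set a h])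
       (fun z => \prod_(h < H) law z (a h))).

End independence.

Section permutation_test.
Variables (n m : nat).

Definition pooled (U : Type) (x : 'I_n -> U) (y : 'I_m -> U) (i : 'I_(n + m)) :
    U :=
  match fintype.split i with inl j => x j | inr j => y j end.

Context (X : Type) (R : realType).

Definition permute (z : (n + m).-tuple X) (s : 'S_(n + m)) :
    (n + m).-tuple X :=
  [tuple tnth z (s i) | i < n + m].

(* rshift n j, for j < m, ranges over the last m of the n + m positions. *)
Definition ratio_prod (r : X -> R) (z : (n + m).-tuple X)
    (s : 'S_(n + m)) : R :=
  \prod_(j < m) r (tnth z (s (rshift n j))).

Definition perm_law (r : X -> R) (z : (n + m).-tuple X)
    (s : 'S_(n + m)) : R :=
  ratio_prod r z s / \sum_(t : 'S_(n + m)) ratio_prod r z t.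

Definition pvalue (T : (n + m).-tuple X -> R) (H : nat)
    (z : (n + m).-tuple X) (s : 'I_H -> 'S_(n + m)) : R :=
  (1 + \sum_(h < H) (T z <= T (permute z (s h)))%R%:R) / (1 + H%:R).

(* The terms are nonnegative, so the default value 0 does not affect the max. *)
Definition eta (rhat rstar : X -> R) (z : (n + m).-tuple X) : R :=
  \big[Num.max/0]_(i < n + m)
    `|ln (rhat (tnth z i)) - ln (rstar (tnth z i))|.

End permutation_test.

(* Main.v *)
(* Since |log rhat - log rstar| <= eta(Z) at every sample point, numerator and
   normalising constant of the two permutation laws differ by factors at most
   exp(m eta), so law_rhat >= c law_rstar pointwise with c = exp(-2 m eta).
   Given Z, the H-fold product laws then satisfy
   \prod law_rhat >= c^H \prod law_rstar, so every event loses conditional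
   probability at most 1 - c^H <= H (1 - c) <= H sqrt(1 - c). Applied to
   {p <= alpha} and integrated over Z, this is the claim. *)
Require Import Defs.
From mathcomp Require Import all_boot all_order all_algebra.
From mathcomp Require Import perm.
From mathcomp Require Import all_classical all_reals all_analysis.
From mathcomp Require Import measurable_realfun.

Set Implicit Arguments.
Unset Strict Implicit.
Unset Printing Implicit Defensive.

Import Order.TTheory GRing.Theory Num.Theory.
Import numFieldNormedType.Exports.

Local Open Scope classical_set_scope.
Local Open Scope ring_scope.

(** * Elementary inequalities for powers and product laws *)

Lemma bernoulli_subr (R : realDomainType) (c : R) (k : nat) :
  0 <= c -> c <= 1 -> 1 - c ^+ k <= k%:R * (1 - c).
Proof.
move=> c0 c1; elim: k => [|k IHk]; first by rewrite expr0 subrr mul0r.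
have -> : 1 - c ^+ k.+1 = (1 - c ^+ k) * c + (1 - c).
  by rewrite exprSr mulrBl mul1r [RHS]addrC addrA subrK.
rewrite -[k.+1%:R]natr1 [leRHS]mulrDl mul1r lerD2r.
by apply: le_trans IHk; rewrite ler_piMr// subr_ge0 exprn_ile1.
Qed.

(** Here [p] and [q] are one-draw laws and [u] is a test function of the [H] draws. Since
    [\prod q >= c ^+ H * \prod p], the loss at each [a] is at most [(1 - c ^+ H) * \prod p], and
    these bounds add up to [1 - c ^+ H]. *)
Lemma sum_prod_le (R : realDomainType) (A : finType) (H : nat) (p q : A -> R)
    (c : R) (u : {ffun 'I_H -> A} -> R) :
    0 <= c -> c <= 1 -> (forall a, 0 <= p a) -> \sum_a p a = 1 ->
    (forall a, c * p a <= q a) -> (forall a, 0 <= u a <= 1) ->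
  \sum_a u a * \prod_(h < H) p (a h) <=
  \sum_a u a * \prod_(h < H) q (a h) + H%:R * (1 - c).
Proof.
move=> c0 c1 p0 p1 pq u01.
have sum_prodp : \sum_(a : {ffun 'I_H -> A}) \prod_(h < H) p (a h) = 1.
  rewrite -(bigA_distr_bigA (fun=> p)).
  by apply: big1 => h _.
apply: le_trans (_ : _ <= \sum_a u a * \prod_h q (a h) + (1 - c ^+ H)) _;
  last first.
  by rewrite lerD2l bernoulli_subr.
(* The constant is spread over the points [a] with weights [\prod p], so that the comparison can be
   made term by term. *)
have -> : 1 - c ^+ H =
    \sum_(a : {ffun 'I_H -> A}) (1 - c ^+ H) * \prod_(h < H) p (a h).
  by rewrite -mulr_sumr sum_prodp mulr1.
rewrite -big_split/=.
apply: ler_sum => a _; case/andP: (u01 a) => u0 u1.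
have cpq : c ^+ H * \prod_(h < H) p (a h) <= \prod_(h < H) q (a h).
  rewrite -[X in c ^+ X]card_ord -prodr_const -big_split/=.
  by apply: ler_prod => h _; rewrite mulr_ge0/=.
have prodp0 : 0 <= \prod_(h < H) p (a h) by apply: prodr_ge0.
rewrite -lerBlDr; apply: (le_trans _ (ler_wpM2l u0 cpq)); rewrite lerBlDr.
rewrite -lerBlDl -mulrBr -[X in X - _]mul1r -mulrBl ler_piMl//.
by rewrite mulr_ge0// subr_ge0 exprn_ile1.
Qed.

(** * Comparison of the permutation laws of two ratio functions *)

Section perm_law.
Context (n m : nat) (X : Type) (R : realType).
Implicit Types (r : X -> R) (z : (n + m).-tuple X).

Lemma ratio_prod_gt0 r z (s : 'S_(n + m)) :
  (forall x, 0 < r x) -> 0 < ratio_prod r z s.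
Proof. by move=> r0; apply: prodr_gt0. Qed.

Lemma sum_ratio_prod_gt0 r z :
  (forall x, 0 < r x) -> 0 < \sum_(t : 'S_(n + m)) ratio_prod r z t.
Proof.
move=> r0; rewrite (bigD1 (1%g : 'S_(n + m)))//= ltr_wpDr ?ratio_prod_gt0//.
by apply: sumr_ge0 => t _; rewrite ltW ?ratio_prod_gt0.
Qed.

Lemma perm_law_ge0 r z (s : 'S_(n + m)) :
  (forall x, 0 < r x) -> 0 <= perm_law r z s.
Proof.
by move=> r0; rewrite ltW// divr_gt0 ?ratio_prod_gt0 ?sum_ratio_prod_gt0.
Qed.

Lemma sum_perm_law r z :
  (forall x, 0 < r x) -> \sum_(s : 'S_(n + m)) perm_law r z s = 1.
Proof.
by move=> r0; rewrite -mulr_suml divff// gt_eqF ?sum_ratio_prod_gt0.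
Qed.

Lemma etaC r1 r2 z : eta r1 r2 z = eta r2 r1 z.
Proof. by apply: eq_bigr => i _; rewrite distrC. Qed.

Lemma eta_ge0 r1 r2 z : 0 <= eta r1 r2 z.
Proof.
by rewrite /eta; elim/big_ind: _ => // x y x0 y0; rewrite le_max x0.
Qed.

(** At each sample point [ln r1 - ln r2 <= eta], so each of the [m] factors obeys
    [expR (- eta) * r1 <= r2]. *)
Lemma ratio_prod_le r1 r2 z (s : 'S_(n + m)) :
    (forall x, 0 < r1 x) -> (forall x, 0 < r2 x) ->
  expR (- (m%:R * eta r1 r2 z)) * ratio_prod r1 z s <= ratio_prod r2 z s.
Proof.
move=> r10 r20.
rewrite -mulrN [m%:R * _]mulrC expRM_natr.
rewrite -[X in _ ^+ X]card_ord -prodr_const -big_split/=.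
apply: ler_prod => j _; set x := tnth z _.
rewrite mulr_ge0 ?expR_ge0 ?(ltW (r10 _))//=.
rewrite -[X in _ * X](lnK (r10 x)) -expRD -[leRHS](lnK (r20 x)) ler_expR.
rewrite addrC lerBlDr -lerBlDl; apply: le_trans (ler_norm _) _.
exact: (le_bigmax _ (fun i => `|ln (r1 (tnth z i)) - ln (r2 (tnth z i))|)).
Qed.

(** The numerator costs one factor [expR (- (m * eta))]; the normalising sum costs another, with
    [r1] and [r2] exchanged. Hence the 2. *)
Lemma perm_law_le r1 r2 z (s : 'S_(n + m)) :
    (forall x, 0 < r1 x) -> (forall x, 0 < r2 x) ->
  expR (- (2 * m%:R * eta r1 r2 z)) * perm_law r1 z s <= perm_law r2 z s.
Proof.
move=> r10 r20.
have S1 := sum_ratio_prod_gt0 z r10; have S2 := sum_ratio_prod_gt0 z r20.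
(* Cross-multiplying by the positive sums leaves a product of two inequalities, one for numerators
   and one for sums. *)
rewrite /perm_law mulrA ler_pdivrMr// [leRHS]mulrAC ler_pdivlMr//.
rewrite -[leLHS]mulrA -[2 * _ * _]mulrA mulr_natl mulr2n opprD expRD mulrACA.
apply: ler_pM; rewrite ?mulr_ge0 ?expR_ge0 ?ratio_prod_le//.
- by rewrite ltW ?ratio_prod_gt0.
- exact: ltW.
rewrite etaC mulr_sumr; apply: ler_sum => t _.
exact: ratio_prod_le.
Qed.

End perm_law.

(** * Probabilities of events determined by [Z] and the conditionally i.i.d. draws *)

Section conditional_law.
Context d (Omega : measurableType d) (R : realType) (P : probability Omega R).
Context d' (S : measurableType d') (Z : Omega -> S).
Context (A : finType) (H : nat) (sigma : 'I_H -> Omega -> A).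
Context (law : S -> A -> R).
Hypotheses (mZ : measurable_fun setT Z) (law_ge0 : forall z a, 0 <= law z a).
Hypothesis iid : cond_iid P Z sigma law.
Variable B : {ffun 'I_H -> A} -> set S.
Hypothesis mB : forall a, measurable (B a).

(** Fixing the draws to be [a] turns the event into a condition on [Z] alone. Finite functions index
    the cells, so that there are finitely many. *)
Let cell (a : {ffun 'I_H -> A}) : set Omega :=
  (\bigcap_(h in [set: 'I_H]) sigma h @^-1` [set a h]) `&` Z @^-1` B a.

Local Notation term a w :=
  (\1_(B a) (Z w) * \prod_(h < H) law (Z w) (a h)).

Let measurable_preZ (C : set S) : measurable C -> measurable (Z @^-1` C).
Proof. by move=> mC; rewrite -[_ @^-1` _]setTI; exact: mZ. Qed.

Lemma measurable_cond_iid_term a : measurable_fun setT (fun w => term a w : R).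
Proof.
have [_ mq _] := iid.2 a.
apply: measurable_funM.
  by apply: measurableT_comp mZ; exact: measurable_indic.
exact: measurableT_comp mq mZ.
Qed.

(** The cells partition the event. On each, the joint clause of [cond_iid] is integrated over [Z] in
    [B a]; nonnegativity of the terms lets the sum pass inside the integral. *)
Lemma prob_cond_iid :
  P [set w | B [ffun h => sigma h w] (Z w)] =
  (\int[P]_w (\sum_a term a w)%:E)%E.
Proof.
have mcell a : measurable (cell a).
  have [mE _ _] := iid.2 a.
  by apply: measurableI => //; exact: measurable_preZ.
have Pcell a : (P (cell a) = \int[P]_w (term a w)%:E)%E.
  have [_ _ ->] := iid.2 a; last exact: mB.
  rewrite integral_mkcond; apply: eq_integral => w _.
  rewrite patchE/= indicE.
  have -> : (w \in Z @^-1` B a) = (Z w \in B a).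
    by apply/idP/idP; rewrite !inE.
  by case: ifPn => _; rewrite ?mul1r ?mul0r.
have -> : [set w | B [ffun h => sigma h w] (Z w)] =
          \bigcup_(a in [set: {ffun 'I_H -> A}]) cell a.
  apply/seteqP; split => [w /= Bw|w [a _ [/= sa Ba]]].
    by exists [ffun h => sigma h w] => //; split => // h _; rewrite /= ffunE.
  suff -> : [ffun h => sigma h w] = a by [].
  by apply/ffunP => h; rewrite ffunE; exact: sa.
have tcell : trivIset setT cell.
  move=> a b _ _ [w [[/= sa _] [/= sb _]]].
  by apply/ffunP => h; rewrite -(sa h I) -(sb h I).
rewrite (measure_fin_bigcup _ finite_finset tcell (fun a _ => mcell a)).
rewrite (fsbigE (index_enum _)) ?index_enum_uniq//; last first.
  by move=> a _; rewrite mem_index_enum.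
under eq_bigl do rewrite in_setT.
under [RHS]eq_integral do rewrite -sumEFin.
rewrite ge0_integral_sum//.
- by apply: eq_bigr => a _; exact: Pcell.
- by move=> a; apply/measurable_EFinP; exact: measurable_cond_iid_term.
- move=> a w _; rewrite lee_fin mulr_ge0// ?prodr_ge0//.
Qed.

End conditional_law.

(** * Measurability of [eta] and of the p-value at fixed permutations *)

Lemma measurable_bigmaxr d (T : measurableType d) (R : realType) (D : set T)
    (I : Type) (s : seq I) (F : I -> T -> R) (x0 : R) :
    (forall i, measurable_fun D (F i)) ->
  measurable_fun D (fun x => \big[Num.max/x0]_(i <- s) F i x).
Proof.
move=> mF; elim: s => [|i s IHs].
  by under eq_fun do rewrite big_nil; exact: measurable_cst.
under eq_fun do rewrite big_cons.
exact: measurable_maxr.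
Qed.

Lemma measurable_eta d (X : measurableType d) (R : realType) n m
    (r1 r2 : X -> R) :
    measurable_fun setT r1 -> measurable_fun setT r2 ->
  measurable_fun setT (@eta n m X R r1 r2).
Proof.
move=> mr1 mr2; apply: measurable_bigmaxr => i.
apply: measurableT_comp => //; apply: measurable_funB.
- apply: measurableT_comp => //; apply: measurableT_comp mr1 _.
  exact: measurable_tnth.
- apply: measurableT_comp => //; apply: measurableT_comp mr2 _.
  exact: measurable_tnth.
Qed.

Lemma measurable_permute d (X : measurableType d) n m (s : 'S_(n + m)) :
  measurable_fun setT (fun z : (n + m).-tuple X => permute z s).
Proof.
apply/measurable_fun_tnthP => i.
rewrite (_ : _ \o _ = fun z => tnth z (s i)); first exact: measurable_tnth.
by apply/funext => z; rewrite /= tnth_mktuple.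
Qed.

Lemma measurable_pvalue d (X : measurableType d) (R : realType) n m
    (T : (n + m).-tuple X -> R) (H : nat) (s : 'I_H -> 'S_(n + m)) :
  measurable_fun setT T -> measurable_fun setT (fun z => pvalue T z s).
Proof.
move=> mT; apply: measurable_funM; last exact: measurable_cst.
apply: measurable_funD; first exact: measurable_cst.
apply: measurable_sum => h.
(* The cast boolean is an indicator, whose set compares two measurable functions. *)
have -> : (fun z => (T z <= T (permute z (s h)))%R%:R) =
          (\1_[set z | T z <= T (permute z (s h))] : _ -> R).
  apply/funext => z; rewrite indicE; congr (nat_of_bool _)%:R.
  by apply/idP/idP; rewrite inE.
apply: measurable_indic; rewrite -[X in measurable X]setTI.
apply: measurable_fun_ler => //.
exact: measurableT_comp mT (measurable_permute _).
Qed.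

(** * Comparison of the two rejection probabilities *)

Theorem proposition13
  (R : realType) (n m : nat) (hn : (1 <= n)%N) (hm : (1 <= m)%N)
  (d : measure_display) (XX : measurableType d)
  (nu : {measure set XX -> \bar R}) (f g : XX -> R)
  (hf : prob_density nu f) (hg : prob_density nu g)
  (d' : measure_display) (Omega : measurableType d') (P : probability Omega R)
  (X : 'I_n -> {RV P >-> XX}) (Y : 'I_m -> {RV P >-> XX})
  (hX : forall i : 'I_n, has_density (X i) nu f)
  (hY : forall j : 'I_m, has_density (Y j) nu g)
  (hindep : independent_RVs (pooled X Y))
  (rstar rhat : XX -> R)
  (mrstar : measurable_fun [set: XX] rstar)
  (mrhat : measurable_fun [set: XX] rhat)
  (rstar_gt0 : forall x, 0 < rstar x) (rhat_gt0 : forall x, 0 < rhat x)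
  (T : (n + m).-tuple XX -> R)
  (mT : measurable_fun [set: (n + m).-tuple XX] T)
  (H : nat) (hH : (1 <= H)%N)
  (sigma_hat sigma_star : 'I_H -> Omega -> 'S_(n + m)) :
  let Z : Omega -> (n + m).-tuple XX :=
    fun w => [tuple pooled X Y i w | i < n + m] in
  cond_iid P Z sigma_hat (perm_law rhat) ->
  cond_iid P Z sigma_star (perm_law rstar) ->
  let p_rhat := fun w => pvalue T (Z w) (fun h => sigma_hat h w) in
  let p_rstar := fun w => pvalue T (Z w) (fun h => sigma_star h w) in
  forall alpha : R, 0 < alpha -> alpha < 1 ->
  (P [set w | (p_rhat w <= alpha)%R] >=
   P [set w | (p_rstar w <= alpha)%R]
   - H%:R%:E *
     'E_P[fun w => Num.sqrt (1 - expR (- (2 * m%:R * eta rhat rstar (Z w))))])%E.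
Proof.
move=> Z iid_hat iid_star p_rhat p_rstar alpha _ _.
have mZ : measurable_fun setT Z.
  apply/measurable_fun_tnthP => i.
  rewrite (_ : _ \o _ = pooled X Y i); first exact: measurable_funPT.
  by apply/funext => w; rewrite /= tnth_mktuple.
pose B (a : {ffun 'I_H -> 'S_(n + m)}) : set ((n + m).-tuple XX) :=
  [set z | pvalue T z a <= alpha].
have mB a : measurable (B a).
  rewrite -[B a]setTI; apply: measurable_fun_ler => //.
  exact: measurable_pvalue.
(* The conditional probability of rejection given [Z], when the draws follow [perm_law r]. *)
pose G (r : XX -> R) w : R := \sum_(a : {ffun 'I_H -> 'S_(n + m)})
  \1_(B a) (Z w) * \prod_(h < H) perm_law r (Z w) (a h).
have PE (r : XX -> R) (sigma : 'I_H -> Omega -> 'S_(n + m)) :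
    (forall x, 0 < r x) -> cond_iid P Z sigma (perm_law r) ->
  P [set w | pvalue T (Z w) (fun h => sigma h w) <= alpha] =
  (\int[P]_w (G r w)%:E)%E.
  move=> r0 iid; rewrite -(prob_cond_iid mZ _ iid mB); last first.
    by move=> z s; exact: perm_law_ge0.
  congr (P _); apply/funext => w; rewrite /B /=; congr (pvalue _ _ _ <= _ = _).
  by apply/funext => h; rewrite ffunE.
pose c w := expR (- (2 * m%:R * eta rhat rstar (Z w))).
pose e w := Num.sqrt (1 - c w).
rewrite -/e.
have me : measurable_fun setT e.
  rewrite /e; apply: measurableT_comp.
    exact: continuous_measurable_fun (@sqrt_continuous R).
  apply: measurable_funB => //; apply: measurableT_comp => //.
  apply: measurableT_comp => //; apply: measurable_funM => //.
  exact: measurableT_comp (measurable_eta _ _) mZ.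
have e_ge0 w : 0 <= e w by exact: sqrtr_ge0.
have c01 w : 0 <= c w <= 1.
  by rewrite expR_ge0 -expR0 ler_expR oppr_le0 !mulr_ge0 ?eta_ge0.
have e_le1 w : e w <= 1.
  by rewrite -sqrtr1 ler_wsqrtr// gerBl; case/andP: (c01 w).
(* As [1 - c w] lies in [0, 1], its square is at most itself; take square roots. *)
have c_le_e w : 1 - c w <= e w.
  case/andP: (c01 w) => c0 c1; rewrite -subr_ge0 in c1.
  rewrite -[leLHS]ger0_norm// -sqrtr_sqr ler_wsqrtr// expr2 ler_piMl//.
  by rewrite gerBl.
(* Finiteness is what allows the error term to change sides in the extended reals; it follows from
   [0 <= e <= 1]. *)
have Ee_fin : (\int[P]_w (e w)%:E)%E \is a fin_num.
  rewrite ge0_fin_numE; last by apply: integral_ge0 => w _; rewrite lee_fin.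
  apply: (@le_lt_trans _ _ (\int[P]_w 1)%E); last first.
    rewrite integral_cst// mul1e.
    exact: le_lt_trans (probability_le1 P measurableT) (ltry _).
  apply: ge0_le_integral => //; first by move=> w _; rewrite lee_fin.
    exact/measurable_EFinP.
  by move=> w _; rewrite lee_fin.
rewrite unlock leeBlDr ?fin_numM//.
rewrite (PE _ _ rhat_gt0 iid_hat) (PE _ _ rstar_gt0 iid_star).
have G_ge0 (r : XX -> R) w : (forall x, 0 < r x) -> 0 <= G r w.
  move=> r0; apply: sumr_ge0 => a _; rewrite mulr_ge0// prodr_ge0// => h _.
  exact: perm_law_ge0.
have mG (r : XX -> R) (sigma : 'I_H -> Omega -> 'S_(n + m)) :
    cond_iid P Z sigma (perm_law r) -> measurable_fun setT (G r).
  move=> iid; apply: measurable_sum => a.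
  exact: (measurable_cond_iid_term mZ iid mB).
rewrite -ge0_integralZl_EFin//; last 2 first.
- by move=> w _; rewrite lee_fin.
- exact/measurable_EFinP.
rewrite -ge0_integralD//; last 4 first.
- by move=> w _; rewrite lee_fin G_ge0.
- by apply/measurable_EFinP; exact: mG iid_hat.
- by move=> w _; rewrite mule_ge0// lee_fin.
- by apply/measurable_EFinP; exact: measurable_funM.
apply: ge0_le_integral => //.
- by move=> w _; rewrite lee_fin G_ge0.
- by apply/measurable_EFinP; exact: mG iid_star.
- apply: emeasurable_funD; apply/measurable_EFinP; first exact: mG iid_hat.
  exact: measurable_funM.
move=> w _; rewrite -EFinM -EFinD lee_fin.
(* It suffices to bound the loss by [H * (1 - c w)]: this is [sum_prod_le] at fixed [w], with [p]
   the law of [rstar], [q] that of [rhat], and [u] the rejection indicator. *)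
apply: (le_trans _ (lerD (lexx _) (ler_wpM2l (ler0n R H) (c_le_e w)))).
apply: sum_prod_le.
- exact: expR_ge0.
- by case/andP: (c01 w).
- by move=> s; exact: perm_law_ge0.
- exact: sum_perm_law.
- by move=> s; rewrite /c etaC; exact: perm_law_le.
- by move=> a; rewrite indicE; case: (_ \in _); rewrite ?lexx ?ler01.
Qed.
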